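(* Let $\theta>0$ and let $K_n^{\eta}$ be the number of cycles of the playground game process $\eta^{n,\theta}$. For $n>3$, $$\mathbb{E}(K_n^{\eta})=1+\sum_{i=3}^{n-1}\frac{\theta}{\theta+i-1}+\sum_{j=2}^{n-3}\sum_{i=3}^{n-j}\frac{(-1)^{j+1}\theta^j}{(\theta+i-1)_{(j)}},$$ and $$\lim_{n\to\infty}\bigl(\mathbb{E}(K_n^{\eta})-\theta\log n\bigr)=1-\theta H_{\theta+1}+\theta\gamma-\theta^2\int_0^1\int_0^1 e^{-\theta xy}(1-x)^{\theta+1}\,dx\,dy,$$ where $\gamma$ is the Euler constant and $H_y=\int_0^1\frac{1-x^y}{1-x}\,dx$.
   Context: Playground game process: fix $\theta>0$ and put $p_1=0$, $p_2=1$, $p_i=\frac{i-1}{i-1+\theta}$ for $i\ge 3$, $q_i=1-p_i$. For $n\ge 2$, $\eta=\eta^{n,\theta}=(\eta_{n+1}=1,\eta_n,\dots,\eta_1)$ is the $\{0,1\}$-valued inhomogeneous Markov chain, run in decreasing index and started from $\eta_{n+1}=1$, such that $\eta_n=0$ a.s., $\eta_1=1$ a.s., and for $2\le r\le n-1$: $\mathbb{P}(\eta_r=0\mid\eta_{r+1}=0)=p_r$, $\mathbb{P}(\eta_r=1\mid\eta_{r+1}=0)=q_r$, $\mathbb{P}(\eta_r=0\mid\eta_{r+1}=1)=1$. The number of cycles is $K_n^{\eta}=\sum_{i=1}^n\eta_i$. Notation: $x_{(m)}=x(x+1)\cdots(x+m-1)$, $x_{(0)}=1$; empty sums are $0$;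 $\gamma=\lim_{n\to\infty}(\sum_{i=1}^n 1/i-\log n)$. *)

(* Defs.v *)
From mathcomp Require Export all_boot all_order all_algebra.
From mathcomp Require Export all_classical all_reals all_analysis.
Set Implicit Arguments.
Unset Strict Implicit.
Unset Printing Implicit Defensive.
Import Order.TTheory GRing.Theory Num.Theory.
Import numFieldNormedType.Exports.
Local Open Scope classical_set_scope.
Local Open Scope ring_scope.

(* The rising factorial x_(m) = x (x + 1) ... (x + m - 1). *)
Definition rising (R : realType) (x : R) (m : nat) : R :=
  \prod_(k < m) (x + k%:R).

Definition euler_gamma (R : realType) : R :=
  limn (fun n : nat => (\sum_(1 <= i < n.+1) i%:R^-1) - ln (n%:R : R)).

(* The integrand is 0 at x = 1, by the convention 0^-1 = 0. *)
Definition Hfun (R : realType) (y : R) : R :=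
  \int[lebesgue_measure]_(x in `[0, 1]) ((1 - x `^ y) / (1 - x)).

(* P(A | B), meaningful only when P B != 0. *)
Definition cond_prob d (T : measurableType d) (R : realType)
    (P : probability T R) (A B : set T) : R :=
  fine (P (A `&` B)) / fine (P B).

Section playground.
Context (R : realType) (theta : R).

Definition pg_p (i : nat) : R :=
  if i == 1%N then 0 else
  if i == 2%N then 1 else i.-1%:R / (i.-1%:R + theta).

Definition pg_q (i : nat) : R := 1 - pg_p i.

Context d (T : measurableType d) (P : probability T R).

(* The value 1 is [true]. Only the indices 1, ..., n + 1 of [eta] matter; the
   chain is run from index n + 1 down to index 1. *)
Section chain.
Context (n : nat) (eta : nat -> {RV P >-> bool}).

Definition pg_at (r : nat) (b : bool) : set T := [set w | eta r w = b].

Definition pg_history (r : nat) (x : nat -> bool) : set T :=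
  [set w | forall s, (r < s <= n.+1)%N -> eta s w = x s].

(* Conditional probabilities are constrained only when the conditioning event
   has nonzero probability; e.g. {eta_n = 1} is a null event. *)
Record playground_game : Prop := PlaygroundGame {
  pg_start : P (pg_at n.+1 true) = 1%E ;
  pg_top : P (pg_at n false) = 1%E ;
  pg_bottom : P (pg_at 1 true) = 1%E ;
  pg_markov : forall (r : nat) (b : bool) (x : nat -> bool),
    (1 <= r <= n)%N -> P (pg_history r x) != 0%E ->
    cond_prob P (pg_at r b) (pg_history r x) =
    cond_prob P (pg_at r b) (pg_at r.+1 (x r.+1)) ;
  pg_step00 : forall r : nat, (2 <= r <= n.-1)%N ->
    P (pg_at r.+1 false) != 0%E ->
    cond_prob P (pg_at r false) (pg_at r.+1 false) = pg_p r ;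
  pg_step01 : forall r : nat, (2 <= r <= n.-1)%N ->
    P (pg_at r.+1 false) != 0%E ->
    cond_prob P (pg_at r true) (pg_at r.+1 false) = pg_q r ;
  pg_step10 : forall r : nat, (2 <= r <= n.-1)%N ->
    P (pg_at r.+1 true) != 0%E ->
    cond_prob P (pg_at r false) (pg_at r.+1 true) = 1 }.

Definition num_cycles (w : T) : R := \sum_(1 <= i < n.+1) (eta i w : nat)%:R.

End chain.
End playground.

(* Main.v *)
(* With a_r = P(eta_r = 1) the chain gives a_n = 0, a_1 = 1 and
   a_r = q_r (1 - a_{r+1}), where q_2 = 0; unrolling the recursion yields the
   finite formula.  In it the sum over i telescopes,
     1 / x_(j) = (1 / x_(j-1) - 1 / (x+1)_(j-1)) / (j - 1),
   up to a remainder which is O(1/n).  The single sum is theta times a shifted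
   harmonic sum, whose defect from the harmonic sum tends to H_{theta+1} (expand
   1 / (1 - x) geometrically).  Expanding e^{- theta x y} in power series, and
   using the Beta integral int_0^1 x^k (1-x)^a dx = k! / (a+1)_(k+1), identifies
   the telescoped series with the double integral. *)
Require Import Defs.
From mathcomp Require Import all_boot all_order all_algebra.
From mathcomp Require Import all_classical all_reals all_analysis.
From mathcomp Require Import measurable_realfun ring lra zify.
Import Order.TTheory GRing.Theory Num.Theory.
Import numFieldNormedType.Exports.
Local Open Scope classical_set_scope.
Local Open Scope ring_scope.

(** * Integrals over the unit interval *)
Section unit_interval_integrals.
Variable R : realType.
Notation mu := (@lebesgue_measure R).

Lemma lebesgue_measure_itv01 : mu `[0, 1]%classic = 1%E.
Proof. by rewrite lebesgue_measure_itv/= lte_fin ltr01 oppr0 adde0. Qed.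

Lemma integrable_itv01 (f : R -> R) (M : R) :
  measurable_fun `[(0 : R), 1] f -> (forall x, 0 <= x <= 1 -> `|f x| <= M) ->
  mu.-integrable `[(0 : R), 1] (EFin \o f).
Proof.
move=> mf fM; apply: measurable_bounded_integrable => //.
  by rewrite /= lebesgue_measure_itv01 ltry.
exists M; split; first exact: num_real.
move=> x Mx y; rewrite /= in_itv/= => y01.
exact: le_trans (fM _ y01) (ltW Mx).
Qed.

Lemma norm_Rintegral_itv01 (f : R -> R) (M : R) :
  measurable_fun `[(0 : R), 1] f -> (forall x, 0 <= x <= 1 -> `|f x| <= M) ->
  `|\int[mu]_(x in `[0, 1]) f x| <= M.
Proof.
move=> mf fM.
have int_f := integrable_itv01 f M mf fM.
apply: (le_trans (le_normr_Rintegral _ int_f)) => //.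
have -> : M = \int[mu]_(x in `[0, 1]) M.
  by rewrite Rintegral_cst//= lebesgue_measure_itv01/= mulr1.
apply: le_Rintegral => //.
- apply: (integrable_itv01 _ M); first exact: measurableT_comp.
  by move=> x /fM; rewrite normr_id.
- exact: (integrable_itv01 _ `|M|).
Qed.

(** Dominated convergence with the constant [M] as majorant, integrable because the interval has
    measure 1. *)
Lemma bounded_cvg_Rintegral_itv01 (f : nat -> R -> R) (g : R -> R) (M : R) :
  (forall n, measurable_fun `[(0 : R), 1] (f n)) ->
  (forall n x, 0 <= x <= 1 -> `|f n x| <= M) ->
  (forall x, 0 <= x <= 1 -> f n x @[n --> \oo] --> g x) ->
  measurable_fun `[(0 : R), 1] g /\
  \int[mu]_(x in `[0, 1]) f n x @[n --> \oo] --> \int[mu]_(x in `[0, 1]) g x.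
Proof.
move=> mf fM fg.
have fgE x : `[0, 1]%classic x ->
    (f n x)%:E @[n --> \oo] --> (g x)%:E.
  by rewrite /= in_itv/= => /fg; exact: cvg_EFin (nearW _ _).
have mg : measurable_fun `[(0 : R), 1] g.
  apply/measurable_EFinP.
  apply: (emeasurable_fun_cvg (fun n x => (f n x)%:E)) => // n.
  exact/measurable_EFinP.
split=> //.
have [| | | | |ig _ cv] := @dominated_convergence _ _ R mu `[(0 : R), 1]%classic
  (measurable_itv _) (fun n x => (f n x)%:E) (EFin \o g) (cst M%:E).
- by move=> n; apply/measurable_EFinP; exact: mf.
- by apply/measurable_EFinP; exact: mg.
- by apply: aeW => x x01; exact: fgE.
- exact: (integrable_itv01 (cst M) `|M| (measurable_cst _) (fun _ _ => lexx _)).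
- by apply: aeW => x n /=; rewrite in_itv/= lee_fin; exact: fM.
apply: fine_cvg; rewrite fineK//; exact: integrable_fin_num.
Qed.

Lemma measurable_powR_itv01 (a : R) :
  measurable_fun `[(0 : R), 1] (fun x : R => x `^ a).
Proof. exact: measurable_funTS. Qed.

Lemma powR_le1 (x a : R) : 0 <= a -> 0 <= x <= 1 -> x `^ a <= 1.
Proof.
move=> a0 /andP[x0 x1]; have <- : 1 `^ a = 1 :> R by rewrite powR1.
by apply: ge0_ler_powR; rewrite ?nnegrE.
Qed.

Lemma cvg_powR0 (a : R) : 0 < a -> x `^ a @[x --> 0^'+] --> (0 : R) `^ a.
Proof. by move=> a0; rewrite powR0 ?gt_eqF//; exact: powR_cvg0. Qed.

Lemma continuous_powR_gt0 (a x : R) : 0 < x -> {for x, continuous (@powR R ^~ a)}.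
Proof.
move=> x0; apply/differentiable_continuous/derivable1_diffP.
by apply: derivable_powR; rewrite in_itv/= x0.
Qed.

Lemma within_continuous_powR (a : R) : 0 < a ->
  {within `[0, 1], continuous (@powR R ^~ a)}.
Proof.
move=> a0; apply/continuous_within_itvP => //; split.
- by move=> x; rewrite in_itv/= => /andP[x0 _]; exact: continuous_powR_gt0.
- exact: cvg_powR0.
- by apply: cvg_at_left_filter; exact: continuous_powR_gt0.
Qed.

Lemma Rintegral_powR (a : R) : 0 < a ->
  \int[mu]_(x in `[0, 1]) (x `^ a) = (a + 1)^-1.
Proof.
move=> a0; have a10 : 0 < a + 1 by rewrite addr_gt0.
rewrite /Rintegral (@continuous_FTC2 _ _ (fun x => (a + 1)^-1 * x `^ (a + 1)))//=.
- by rewrite powR0 ?gt_eqF// powR1 mulr0 mulr1 oppr0 addr0.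
- exact: within_continuous_powR.
- split.
  + move=> x; rewrite in_itv/= => /andP[x0 _]; apply: derivableM => //.
    by apply: derivable_powR; rewrite in_itv/= x0.
  + by apply: cvgM; [exact: cvg_cst|exact: cvg_powR0].
  + apply: cvg_at_left_filter; apply: cvgM; first exact: cvg_cst.
    exact: continuous_powR_gt0.
- move=> x; rewrite in_itv/= => /andP[x0 _].
  rewrite derive1Ml; last by apply: derivable_powR; rewrite in_itv/= x0.
  rewrite powR_derive1 ?in_itv/= ?x0// addrK mulrA mulVf ?mul1r//.
  by rewrite gt_eqF.
Qed.

Lemma Rintegral_onem_powR (a : R) : 0 < a ->
  \int[mu]_(x in `[0, 1]) ((1 - x) `^ a) = (a + 1)^-1.
Proof.
move=> a0; rewrite -(Rintegral_powR a a0).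
rewrite (@Rintegration_by_substitution_onem R (@powR R ^~ a) 1) ?lexx ?ler01//.
  by rewrite unstable.onem1.
by apply: within_continuous_powR.
Qed.
End unit_interval_integrals.

(** * Rising factorials *)

Section rising.
Variable R : realType.

Lemma rising0 (x : R) : rising x 0 = 1.
Proof. by rewrite /rising big_ord0. Qed.

Lemma risingSr (x : R) m : rising x m.+1 = rising x m * (x + m%:R).
Proof. by rewrite /rising big_ord_recr. Qed.

Lemma risingSl (x : R) m : rising x m.+1 = x * rising (x + 1) m.
Proof.
rewrite /rising big_ord_recl/= addr0; congr (_ * _).
by apply: eq_bigr => i _; rewrite /bump/= -addrA -natr1 [1 + _]addrC natr1.
Qed.

Lemma rising_gt0 (x : R) m : 0 < x -> 0 < rising x m.
Proof. by move=> x0; apply: prodr_gt0 => i _; rewrite ltr_wpDr. Qed.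
End rising.

(** * Integrals of finite sums, the Beta integral and monomials *)

Section integrals.
Variable R : realType.
Notation mu := (@lebesgue_measure R).

Lemma exprn_le1_itv01 (x : R) k : 0 <= x <= 1 -> `|x ^+ k| <= 1.
Proof. by move=> /andP[x0 x1]; rewrite ger0_norm ?exprn_ge0// exprn_ile1. Qed.

(** Each term is measurable and bounded, hence integrable, so linearity applies by induction on [N].
    Measurability of the sum is kept in the conclusion because bounded convergence asks for it. *)
Lemma Rintegral_sum_itv01 (c : nat -> R) (g : nat -> R -> R) N :
  (forall k, measurable_fun `[(0 : R), 1] (g k)) ->
  (forall k x, 0 <= x <= 1 -> `|g k x| <= 1) ->
  measurable_fun `[(0 : R), 1] (fun x => \sum_(0 <= k < N) c k * g k x) /\
  \int[mu]_(x in `[0, 1]) (\sum_(0 <= k < N) c k * g k x) =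
  \sum_(0 <= k < N) c k * \int[mu]_(x in `[0, 1]) g k x.
Proof.
move=> mg g1.
have mcg k : measurable_fun `[(0 : R), 1] (fun x => c k * g k x).
  exact: measurable_funM.
have ms n : measurable_fun `[(0 : R), 1] (fun x => \sum_(0 <= k < n) c k * g k x).
  by apply: measurable_sum.
split=> //; elim: N => [|N IH].
  under eq_Rintegral do rewrite big_geq//.
  by rewrite Rintegral_cst// mul0r big_geq.
under eq_Rintegral do rewrite big_nat_recr//=.
rewrite RintegralD//=.
- rewrite IH big_nat_recr//= RintegralZl//.
  exact: integrable_itv01 (mg N) (g1 N).
- apply: (@integrable_itv01 _ _ (\sum_(0 <= k < N) `|c k|)) => // x x01.
  apply: le_trans (ler_norm_sum _ _ _) _; apply: ler_sum => k _.
  by rewrite normrM ler_piMr// g1.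
- apply: (@integrable_itv01 _ _ `|c N|) => // x x01.
  by rewrite normrM ler_piMr// g1.
Qed.

Lemma measurable_onem_powR (a : R) :
  measurable_fun `[(0 : R), 1] (fun x : R => (1 - x) `^ a).
Proof.
apply: measurable_funTS.
apply: (@measurableT_comp _ _ _ _ _ _ (@powR R ^~ a)) => //.
exact: measurable_funB.
Qed.

Lemma measurable_exprn_itv01 k :
  measurable_fun `[(0 : R), 1] (fun x : R => x ^+ k).
Proof. exact: measurable_funX. Qed.

Lemma onem_powR_le1 (x a : R) : 0 <= a -> 0 <= x <= 1 -> `|(1 - x) `^ a| <= 1.
Proof.
move=> a0 /andP[x0 x1]; rewrite ger0_norm ?powR_ge0//.
by apply: powR_le1 => //; rewrite subr_ge0 x1 gerBl.
Qed.

Lemma measurable_exprn_onem_powR k (a : R) :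
  measurable_fun `[(0 : R), 1] (fun x : R => x ^+ k * (1 - x) `^ a).
Proof.
apply: measurable_funM; first exact: measurable_exprn_itv01.
exact: measurable_onem_powR.
Qed.

Lemma exprn_onem_powR_le1 k (a x : R) : 0 <= a -> 0 <= x <= 1 ->
  `|x ^+ k * (1 - x) `^ a| <= 1.
Proof.
move=> a0 x01; rewrite normrM mulr_ile1//; first exact: exprn_le1_itv01.
exact: onem_powR_le1.
Qed.

(** Induction on [k] for all [a] at once: writing one factor x as 1 - (1 - x) lowers the power of x
    and leaves the exponents [a] and [a + 1]. *)
Lemma Rintegral_beta k (a : R) : 0 < a ->
  \int[mu]_(x in `[0, 1]) (x ^+ k * (1 - x) `^ a) =
  k`!%:R / rising (a + 1) k.+1.
Proof.
elim: k a => [|k IH] a a0.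
  under eq_Rintegral do rewrite expr0 mul1r.
  by rewrite Rintegral_onem_powR// risingSr rising0 addr0 !mul1r.
transitivity (\int[mu]_(x in `[0, 1])
    (x ^+ k * (1 - x) `^ a - x ^+ k * (1 - x) `^ (a + 1))).
  apply: eq_Rintegral => x; rewrite inE/= in_itv/= => /andP[x0 x1].
  (* At x = 1 the base is 0; the exponent law holds there because [a + 1] is nonzero. *)
  rewrite powRD; last by rewrite gt_eqF// addr_gt0.
  rewrite powRr1 ?subr_ge0//; rewrite exprSr; ring.
have a10 : 0 < a + 1 by rewrite addr_gt0.
rewrite RintegralB//=; last 2 first.
- apply: (@integrable_itv01 _ _ 1); first exact: measurable_exprn_onem_powR.
  by move=> x; apply: exprn_onem_powR_le1; exact: ltW.
- apply: (@integrable_itv01 _ _ 1); first exact: measurable_exprn_onem_powR.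
  by move=> x; apply: exprn_onem_powR_le1; exact: ltW.
rewrite !IH// factS natrM.
(* All rising factorials are reduced to the common block [rising (a + 1 + 1) k]. *)
rewrite [in RHS]risingSl [in RHS]risingSr [rising (a + 1) k.+1]risingSl.
rewrite [rising (a + 1 + 1) k.+1]risingSr.
have : rising (a + 1 + 1) k != 0 by rewrite gt_eqF// rising_gt0// addr_gt0.
have : a + 1 + 1 + k%:R != 0 by rewrite gt_eqF// ltr_wpDr// addr_gt0.
have : a + 1 != 0 by rewrite gt_eqF.
rewrite -[k.+1%:R]natr1.
by move=> *; field; apply/and3P.
Qed.

Lemma Rintegral_exprn k : \int[mu]_(x in `[0, 1]) (x ^+ k) = (k.+1%:R)^-1 :> R.
Proof.
case: k => [|k].
  under eq_Rintegral do rewrite expr0.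
  by rewrite Rintegral_cst//= lebesgue_measure_itv01/= mulr1 invr1.
rewrite -natr1 -Rintegral_powR//.
apply: eq_Rintegral => x; rewrite inE/= in_itv/= => /andP[x0 _].
by rewrite powR_mulrn.
Qed.
End integrals.

(** * Limits of the integral expansions *)
Section limits.
Variable R : realType.
Notation mu := (@lebesgue_measure R).

Lemma cvg_ext (T : Type) (F : set_system T) (f g : T -> R) (l : R) :
  f =1 g -> g x @[x --> F] --> l -> f x @[x --> F] --> l.
Proof. by move=> fg; rewrite (eq_cvg _ _ fg). Qed.

(* The factor [1 *] puts the sum in the shape of [Rintegral_sum_itv01]. *)
Lemma geometric_powR_sum_le (y x : R) (m N : nat) : 0 <= y <= m%:R ->
  0 <= x <= 1 -> `|\sum_(0 <= k < N) 1 * (x ^+ k * (1 - x `^ y))| <= m%:R.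
Proof.
move=> /andP[y0 ym] x01; have /andP[x0 x1] := x01.
under eq_bigr do rewrite mul1r.
rewrite -mulr_suml.
have sge n : 0 <= \sum_(0 <= k < n) x ^+ k.
  by apply: sumr_ge0 => k _; exact: exprn_ge0.
have xy1 : x `^ y <= 1 by exact: powR_le1.
rewrite ger0_norm ?mulr_ge0 ?subr_ge0//.
(* For a bound uniform in [N], the exponent [y] is replaced by the integer [m], since 1 - x ^ m is a
   multiple of 1 - x. *)
have xm : x ^+ m <= x `^ y.
  have [->|x_neq0] := eqVneq x 0.
    (* At x = 0 the delicate case is m = 0, where 0 ^ 0 = 1 on the left; then [y] is forced to be 0
       as well. *)
    rewrite expr0n; case: m ym => [ym|m ym]; last by rewrite powR_ge0.
    have -> : y = 0 by apply/eqP; rewrite eq_le y0 andbT.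
    by rewrite powRr0.
  rewrite -powR_mulrn// -(subrKC y m%:R) powRD ?x_neq0 ?implybT//.
  by rewrite ler_piMr ?powR_ge0// powR_le1// subr_ge0.
have geo n : (\sum_(0 <= k < n) x ^+ k) * (1 - x) = 1 - x ^+ n.
  rewrite big_mkord -[LHS]opprK -mulrN opprB mulrC -subrX1 opprB//.
apply: (@le_trans _ _ ((\sum_(0 <= k < N) x ^+ k) * (1 - x ^+ m))).
  by apply: ler_wpM2l => //; exact: lerB.
(* Exchanging the two geometric sums leaves the sum of the first [m] powers times 1 - x ^ N. *)
rewrite -(geo m) mulrCA geo.
apply: (@le_trans _ _ (\sum_(0 <= k < m) x ^+ k)).
  by rewrite ler_piMr// gerBl exprn_ge0.
rewrite -[leRHS]mulr1 -[m in leRHS]subn0 mulr_natl -sumr_const_nat.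
by apply: ler_sum => k _; exact: exprn_ile1.
Qed.

Lemma cvg_geometric_powR_sum (y x : R) : 0 <= x <= 1 ->
  \sum_(0 <= k < N) 1 * (x ^+ k * (1 - x `^ y)) @[N --> \oo] -->
  (1 - x `^ y) / (1 - x).
Proof.
move=> /andP[x0]; rewrite le_eqVlt => /predU1P[->|x1].
  (* At x = 1 every partial sum vanishes, in agreement with the value 0 / 0 = 0 of the limit. *)
  rewrite powR1 subrr mul0r.
  under eq_fun do under eq_bigr do rewrite !mulr0.
  under eq_fun do rewrite big1_eq.
  exact: cvg_cst.
have x1' : `|x| < 1 by rewrite ger0_norm.
apply: cvg_ext (cvg_geometric_series x1') => N.
by apply: eq_bigr => k _; rewrite /geometric/= mul1r mulrC.
Qed.

(** Expand 1 / (1 - x) geometrically and integrate termwise: x ^ k - x ^ (k + y) contributes the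
    k-th summand. Any integer [m] above [y] dominates the partial sums. *)
Lemma cvg_Hfun (y : R) : 0 < y ->
  \sum_(0 <= k < N) (k.+1%:R^-1 - (k.+1%:R + y)^-1) @[N --> \oo] --> Hfun y.
Proof.
move=> y0.
have [m ym] : exists m : nat, y <= m%:R.
  by exists (Num.truncn y).+1; exact: ltW (truncnS_gt y).
have mg k : measurable_fun `[(0 : R), 1] (fun x : R => x ^+ k * (1 - x `^ y)).
  apply: measurable_funM; first exact: measurable_exprn_itv01.
  by apply: measurable_funB => //; exact: measurable_powR_itv01.
have g1 k x : 0 <= x <= 1 -> `|x ^+ k * (1 - x `^ y)| <= 1.
  move=> x01; rewrite normrM mulr_ile1//; first exact: exprn_le1_itv01.
  by rewrite ger0_norm ?gerBl ?powR_ge0// subr_ge0 powR_le1// ltW.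
have [] := @bounded_cvg_Rintegral_itv01 R
  (fun N x => \sum_(0 <= k < N) 1 * (x ^+ k * (1 - x `^ y)))
  (fun x => (1 - x `^ y) / (1 - x)) m%:R.
- by move=> n; apply: (proj1 (Rintegral_sum_itv01 _ _ _ n mg g1)).
- by move=> n x x01; apply: geometric_powR_sum_le => //; rewrite ltW.
- by move=> x; exact: cvg_geometric_powR_sum.
move=> _; apply: cvg_ext => N.
rewrite (proj2 (Rintegral_sum_itv01 _ (fun=> 1) _ N mg g1)).
apply: eq_bigr => k _; rewrite mul1r; apply/esym.
transitivity (\int[mu]_(x in `[0, 1]) (x ^+ k - x `^ (k%:R + y))).
  apply: eq_Rintegral => x; rewrite inE/= in_itv/= => /andP[x0 x1].
  rewrite powRD; last by rewrite gt_eqF// ltr_wpDl.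
  by rewrite powR_mulrn//; ring.
rewrite RintegralB//=.
- rewrite Rintegral_exprn Rintegral_powR ?ltr_wpDl//.
  by rewrite -natr1; congr (_ - _^-1); ring.
- apply: (@integrable_itv01 _ _ 1); first exact: measurable_exprn_itv01.
  by move=> x; exact: exprn_le1_itv01.
- apply: (@integrable_itv01 _ _ 1); first exact: measurable_powR_itv01.
  move=> x x01; rewrite ger0_norm ?powR_ge0// powR_le1// addr_ge0//.
  exact: ltW.
Qed.

(** Termwise comparison with the series at [c], whose partial sums increase to [expR c]. Serves as a
    majorant uniform in [N]. *)
Lemma series_exp_coeff_le (t c : R) N : `|t| <= c ->
  `|series (exp_coeff t) N| <= expR c.
Proof.
move=> tc; apply: (@le_trans _ _ (series (exp_coeff c) N)).
  apply: le_trans (ler_norm_sum _ _ _) _; apply: ler_sum => k _.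
  rewrite /exp_coeff/= normrM normrX normfV normr_nat.
  rewrite ler_wpM2r// ?invr_ge0//; apply: lerXn2r => //.
  by rewrite nnegrE (le_trans _ tc).
have c0 : 0 <= c by exact: le_trans tc.
apply: nondecreasing_cvgn_le; last exact: is_cvg_series_exp_coeff.
apply/nondecreasing_seqP => n; rewrite /series/= big_nat_recr//= lerDl.
by rewrite divr_ge0// exprn_ge0.
Qed.

(** Bounded convergence is applied twice, in x for fixed y and then in y, both times with majorant
    [expR theta], as theta x y is at most theta. In between, the Beta integral cancels the k! and
    turns the partial sums into polynomials in y. *)
Lemma cvg_double_integral (theta a : R) : 0 < theta -> 0 < a ->
  \sum_(0 <= k < N) (- theta) ^+ k / rising (a + 1) k.+1 * k.+1%:R^-1
    @[N --> \oo] -->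
  \int[mu]_(y in `[0, 1]) \int[mu]_(x in `[0, 1])
    (expR (- (theta * x * y)) * (1 - x) `^ a).
Proof.
move=> t0 a0.
have txy (x y : R) : 0 <= x <= 1 -> 0 <= y <= 1 -> `|- (theta * x * y)| <= theta.
  move=> /andP[x0 x1] /andP[y0 y1].
  rewrite normrN ger0_norm ?mulr_ge0//; last exact: ltW.
  by rewrite -mulrA ler_piMr ?(ltW t0)// mulr_ile1.
pose c (y : R) k := (- (theta * y)) ^+ k / k`!%:R.
pose g k (x : R) := x ^+ k * (1 - x) `^ a.
have mg k : measurable_fun `[(0 : R), 1] (g k).
  exact: measurable_exprn_onem_powR.
have g1 k x : 0 <= x <= 1 -> `|g k x| <= 1.
  by apply: exprn_onem_powR_le1; exact: ltW.
have sE N x y : series (exp_coeff (- (theta * x * y))) N * (1 - x) `^ a =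
    \sum_(0 <= k < N) c y k * g k x.
  rewrite /series/= mulr_suml; apply: eq_bigr => k _; rewrite /exp_coeff/= /c /g.
  by rewrite (_ : - (theta * x * y) = - (theta * y) * x) ?exprMn; ring.
have sM N x y : 0 <= x <= 1 -> 0 <= y <= 1 ->
    `|\sum_(0 <= k < N) c y k * g k x| <= expR theta.
  move=> x01 y01; rewrite -sE normrM -[leRHS]mulr1 ler_pM//.
    by apply: series_exp_coeff_le; exact: txy.
  by apply: onem_powR_le1 => //; exact: ltW.
have inner (y : R) : 0 <= y <= 1 ->
    \int[mu]_(x in `[0, 1]) (\sum_(0 <= k < N) c y k * g k x) @[N --> \oo] -->
    \int[mu]_(x in `[0, 1]) (expR (- (theta * x * y)) * (1 - x) `^ a).
  move=> y01.
  have [] // := @bounded_cvg_Rintegral_itv01 R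
    (fun N x => \sum_(0 <= k < N) c y k * g k x)
    (fun x => expR (- (theta * x * y)) * (1 - x) `^ a) (expR theta).
  - by move=> n; exact: (proj1 (Rintegral_sum_itv01 _ (c y) _ n mg g1)).
  - by move=> n x x01; exact: sM.
  - move=> x x01; under eq_fun do rewrite -sE.
    by apply: cvgM; [exact: is_cvg_series_exp_coeff|exact: cvg_cst].
pose e k := (- theta) ^+ k / rising (a + 1) k.+1.
have innerE N y : \int[mu]_(x in `[0, 1]) (\sum_(0 <= k < N) c y k * g k x) =
    \sum_(0 <= k < N) e k * y ^+ k.
  rewrite (proj2 (Rintegral_sum_itv01 _ (c y) _ N mg g1)).
  apply: eq_bigr => k _; rewrite Rintegral_beta// /c /e -mulNr exprMn.
  have kf : (k`!%:R : R) != 0 by rewrite pnatr_eq0 -lt0n fact_gt0.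
  have rn0 : rising (a + 1) k.+1 != 0 by rewrite gt_eqF// rising_gt0// addr_gt0.
  by field; apply/andP.
have mX k : measurable_fun `[(0 : R), 1] (fun y : R => y ^+ k).
  exact: measurable_exprn_itv01.
have X1 k (x : R) : 0 <= x <= 1 -> `|x ^+ k| <= 1 by exact: exprn_le1_itv01.
have [] // := @bounded_cvg_Rintegral_itv01 R
  (fun N y => \sum_(0 <= k < N) e k * y ^+ k)
  (fun y => \int[mu]_(x in `[0, 1]) (expR (- (theta * x * y)) * (1 - x) `^ a))
  (expR theta).
- by move=> n; exact: (proj1 (Rintegral_sum_itv01 _ e _ n mX X1)).
(* Read back as an integral over x, the polynomial in y inherits the bound [expR theta]. *)
- move=> n y y01; rewrite -innerE; apply: norm_Rintegral_itv01.
    exact: (proj1 (Rintegral_sum_itv01 _ (c y) _ n mg g1)).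
  by move=> x x01; exact: sM.
- by move=> y y01; under eq_fun do rewrite -innerE; exact: inner.
move=> _; apply: cvg_ext => N.
rewrite (proj2 (Rintegral_sum_itv01 _ e _ N mX X1)).
by apply: eq_bigr => k _; rewrite Rintegral_exprn.
Qed.

(** As [euler_gamma] is a [limn], the point is that the limit exists: the sequence decreases and is
    bounded below by 0, both by ln (1 + t) <= t. *)
Lemma cvg_euler_gamma :
  (\sum_(1 <= i < n.+1) i%:R^-1) - ln (n%:R : R) @[n --> \oo] --> euler_gamma R.
Proof.
rewrite /euler_gamma.
set u := (fun n : nat => _).
suff : cvgn u by [].
(* The shift discards n = 0, so that only logarithms of positive numbers occur. *)
suff /cvg_ex[l ul] : cvgn [sequence u n.+1]_n.
  by apply/cvg_ex; exists l; rewrite -cvg_shiftS.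
have ln1D n : ln (n.+2%:R : R) - ln n.+1%:R <= n.+1%:R^-1.
  rewrite -ln_div ?posrE// -natr1 mulrDl divff ?pnatr_eq0// mul1r.
  by apply: le_ln1Dx; rewrite (@lt_trans _ _ 0)// ltrN10.
apply: nonincreasing_is_cvgn.
- apply/nonincreasing_seqP => n.
  rewrite /u/= [\sum_(1 <= i < n.+3) _]big_nat_recr//=.
  rewrite -addrA lerD2l.
  have : ln (n.+1%:R / n.+2%:R : R) <= - n.+2%:R^-1.
    rewrite (_ : _ / _ = 1 - n.+2%:R^-1); last first.
      rewrite (_ : n.+1%:R = n.+2%:R - 1) ?mulrBl ?divff ?pnatr_eq0 ?mul1r//.
      by rewrite -[in RHS]natr1 addrK.
    apply: le_ln1Dx; rewrite ltrN2 invf_lt1 ?ltr1n//.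
  rewrite ln_div ?posrE//; move: n.+2%:R^-1 (ln _) (ln _) => a b c; lra.
- exists 0 => _ [n _ <-]; rewrite /u/= subr_ge0.
  (* The last harmonic term is dropped: the sum up to n already dominates ln (n + 1), by induction
     with [ln1D]. *)
  apply: (@le_trans _ _ (\sum_(1 <= i < n.+1) i%:R^-1)); last first.
    by rewrite [leRHS]big_nat_recr//= lerDl.
  elim: n => [|n IH]; first by rewrite ln1 big_geq.
  rewrite big_nat_recr//=; move: (ln1D n) IH.
  by move: n.+1%:R^-1 (ln _) (ln _) (\sum_(_ <= _ < _) _) => a b c e; lra.
Qed.
End limits.

(** * The remainder and the asymptotics *)
Section asymptotics.
Variable R : realType.
Notation mu := (@lebesgue_measure R).

(** The closed form of the theorem, isolated so that its asymptotics involve no probability. *)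
Definition expected_cycles (theta : R) (n : nat) : R :=
  1 + \sum_(3 <= i < n) theta / (theta + i%:R - 1)
    + \sum_(2 <= j < (n - 3).+1) \sum_(3 <= i < (n - j).+1)
        (-1) ^+ j.+1 * theta ^+ j / rising (theta + i%:R - 1) j.

(** The telescoping identity for 1 / x_(j) at j = k + 2, summed by induction on [M]. *)
Lemma sum_invr_rising (x : R) k M : 0 < x ->
  \sum_(0 <= l < M) (rising (x + l%:R) k.+2)^-1 =
  k.+1%:R^-1 * ((rising x k.+1)^-1 - (rising (x + M%:R) k.+1)^-1).
Proof.
move=> x0; elim: M => [|M IH]; first by rewrite big_geq// addr0 subrr mulr0.
rewrite big_nat_recr//= IH.
have y0 : 0 < x + M%:R by rewrite ltr_wpDr.
rewrite -[M.+1%:R]natr1 addrA; move: (x + M%:R) y0 => y y0.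
rewrite [rising y k.+1]risingSl [rising y k.+2]risingSl.
rewrite [rising (y + 1) k.+1]risingSr.
rewrite -[k.+1%:R]natr1.
have r0 : rising (y + 1) k != 0 by rewrite gt_eqF// rising_gt0// addr_gt0.
have r1 : rising x k.+1 != 0 by rewrite gt_eqF// rising_gt0.
have k0 : (k%:R + 1 : R) != 0 by rewrite natr1 pnatr_eq0.
have yk0 : y + 1 + k%:R != 0 by rewrite gt_eqF// ltr_wpDr// addr_gt0.
have yn0 : y != 0 by rewrite gt_eqF.
by field; rewrite k0 yn0 yk0 r0 r1.
Qed.

Lemma fact_le_rising (x : R) k : 1 <= x -> k`!%:R <= rising x k.
Proof.
move=> x1; elim: k => [|k IH]; first by rewrite rising0.
rewrite factS natrM mulrC risingSr ler_pM// -natr1 addrC lerD2r//.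
Qed.

(** Collects the upper ends of the telescoped inner sums for n = N + 4 and j = k + 2, with theta ^ 2
    factored out. *)
Definition telescoping_remainder (theta : R) (N : nat) : R :=
  \sum_(0 <= k < N) (- theta) ^+ k /
    (k.+1%:R * rising (theta + 2 + (N - k)%:R) k.+1).

(** Put j = k + 2 and i = l + 3; the inner sum then has N - k terms and telescopes. Since (-1) ^ (j
    + 1) = - (-1) ^ k, the lower end enters negatively and the upper end positively. *)
Lemma double_sumE (theta : R) N : 0 < theta ->
  \sum_(2 <= j < (N.+4 - 3).+1) \sum_(3 <= i < (N.+4 - j).+1)
        (-1) ^+ j.+1 * theta ^+ j / rising (theta + i%:R - 1) j =
  theta ^+ 2 * telescoping_remainder theta N - theta ^+ 2 *
  \sum_(0 <= k < N) (- theta) ^+ k / rising (theta + 2) k.+1 * k.+1%:R^-1.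
Proof.
move=> t0; rewrite -mulrBr -sumrB mulr_sumr.
rewrite (_ : (N.+4 - 3).+1 = (N + 2)%N); last by lia.
rewrite (big_addn 0 _ 2) addnK; apply: eq_big_nat => k /andP[_ kN].
rewrite (_ : ((N + 2).+2 - (k + 2)).+1 = (N - k + 3)%N); last by lia.
rewrite (big_addn 0 _ 3) addnK -mulr_sumr.
transitivity ((-1) ^+ (k + 2).+1 * theta ^+ (k + 2) *
    \sum_(0 <= l < N - k) (rising (theta + 2 + l%:R) k.+2)^-1).
  congr (_ * _); apply: eq_bigr => l _; rewrite addn2; congr (rising _ _)^-1.
  by rewrite natrD; ring.
rewrite sum_invr_rising ?addr_gt0//.
have t20 : 0 < theta + 2 by rewrite addr_gt0.
have r1 : rising (theta + 2) k.+1 != 0 by rewrite gt_eqF// rising_gt0.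
have r2 : rising (theta + 2 + (N - k)%:R) k.+1 != 0.
  by rewrite gt_eqF// rising_gt0// ltr_wpDr.
have k0 : (k.+1%:R : R) != 0 by rewrite pnatr_eq0.
rewrite addn2 [(- theta) ^+ k]exprNn !exprS invfM.
by ring.
Qed.

(** The k-th denominator is at least k! (N + 1), so the whole sum is at most [expR theta] / (N +
    1). *)
Lemma cvg_telescoping_remainder (theta : R) : 0 < theta ->
  telescoping_remainder theta N @[N --> \oo] --> (0 : R).
Proof.
move=> t0.
have b N : `|telescoping_remainder theta N| <= expR theta * N.+1%:R^-1.
  apply: (@le_trans _ _ (series (exp_coeff theta) N * N.+1%:R^-1)); last first.
    rewrite ler_wpM2r//; apply: le_trans (ler_norm _) _.
    by apply: series_exp_coeff_le; rewrite ger0_norm// ltW.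
  rewrite /series/= mulr_suml.
  apply: le_trans (ler_norm_sum _ _ _) _; apply: ler_sum_nat => k /andP[_ kN].
  have tx : 1 <= theta + 2 + (N - k)%:R.
    by move: (ler0n R (N - k)) t0; move: (N - k)%:R => z; lra.
  have x0 := lt_le_trans ltr01 tx.
  have r0 : 0 < k.+1%:R * rising (theta + 2 + (N - k)%:R) k.+1.
    by rewrite mulr_gt0// rising_gt0.
  rewrite normrM normfV (gtr0_norm r0) normrX normrN gtr0_norm//.
  rewrite /exp_coeff/= -mulrA ler_wpM2l ?exprn_ge0 ?(ltW t0)//.
  rewrite -invfM lef_pV2 ?posrE ?mulr_gt0 ?ltr0n ?fact_gt0 ?rising_gt0//.
  (* The last factor of the rising factorial is at least N + 1, the product of
     the others at least k!. *)
  rewrite -[leLHS]mul1r ler_pM// ?ler1n// risingSr ler_pM//.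
    exact: fact_le_rising.
  rewrite -natr1 -[in leLHS](subnK (ltnW kN)) natrD.
  by move: t0; move: (N - k)%:R k%:R => u v; lra.
have lim0 : expR theta * N.+1%:R^-1 @[N --> \oo] --> (0 : R).
  rewrite -[X in _ --> X](mulr0 (expR theta)).
  by apply: cvgM; [exact: cvg_cst|exact: cvg_harmonic].
have bN : \forall N \near \oo, - (expR theta * N.+1%:R^-1) <=
    telescoping_remainder theta N <= expR theta * N.+1%:R^-1.
  by apply: nearW => m; have := b m; rewrite ler_norml.
apply: (squeeze_cvgr bN _ lim0).
by rewrite -[X in _ --> X]oppr0; exact: cvgN.
Qed.

Lemma cvg_expected_cycles (theta : R) : 0 < theta ->
  expected_cycles theta n - theta * ln n%:R @[n --> \oo] -->
  1 - theta * Hfun (theta + 1) + theta * euler_gamma R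
  - theta ^+ 2 * \int[mu]_(y in `[0, 1]) \int[mu]_(x in `[0, 1])
            (expR (- (theta * x * y)) * (1 - x) `^ (theta + 1)).
Proof.
move=> t0; rewrite -(cvg_shiftn 4).
pose h M := \sum_(0 <= k < M) (k.+1%:R^-1 - (k.+1%:R + (theta + 1))^-1 : R).
pose g n := (\sum_(1 <= i < n.+1) i%:R^-1) - ln (n%:R : R).
pose S N := \sum_(0 <= k < N)
  (- theta) ^+ k / rising (theta + 1 + 1) k.+1 * k.+1%:R^-1.
(* The harmonic sum in [g] runs to N + 4 but the one paired with [h] only to N + 1; [r] holds the
   three surplus terms. *)
pose r (N : nat) := (N + 1).+1%:R^-1 + (N + 2).+1%:R^-1 + (N + 3).+1%:R^-1 : R.
have r0 : r N @[N --> \oo] --> (0 : R).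
  have shift m : (N + m).+1%:R^-1 @[N --> \oo] --> (0 : R).
    by have := @cvg_harmonic R; rewrite -(cvg_shiftn m).
  rewrite -[X in _ --> X](addr0 0) -[X in _ --> X + _](addr0 0).
  by apply: cvgD => //; exact: cvgD.
have uE N : expected_cycles theta (N + 4) - theta * ln (N + 4)%:R =
    1 - theta * h (N + 1)%N + theta * g (N + 4)%N - theta * r N
    + theta ^+ 2 * telescoping_remainder theta N - theta ^+ 2 * S N.
  rewrite addn4 /expected_cycles double_sumE// -/(S N).
  (* With i = k + 3 the summand is theta / (k + 1 + (theta + 1)), theta times the term subtracted in
     [h]. *)
  have -> : \sum_(3 <= i < N.+4) theta / (theta + i%:R - 1) =
      theta * (\sum_(0 <= k < N + 1) k.+1%:R^-1 - h (N + 1)%N).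
    rewrite -sumrB mulr_sumr (big_addn 0 _ 3) addn1.
    apply: eq_big_nat => k _; rewrite opprB addrCA subrr addr0.
    by congr (_ / _); rewrite addn3 -natr1 -[k.+2%:R]natr1; ring.
  have -> : g N.+4 = \sum_(0 <= k < N + 1) k.+1%:R^-1 + r N - ln N.+4%:R.
    rewrite /g big_add1/= addn1 3?big_nat_recr//=.
    by rewrite /r !addnS !addn0 !addrA.
  have -> : S N = \sum_(0 <= k < N)
      (- theta) ^+ k / rising (theta + 2) k.+1 * k.+1%:R^-1.
    by rewrite /S -(addrA theta 1 1).
  by ring.
(* The vanishing limits of [r] and of the remainder are inserted so that the limit has the shape of
   [uE] term by term. *)
have -> : 1 - theta * Hfun (theta + 1) + theta * euler_gamma R
  - theta ^+ 2 * \int[mu]_(y in `[0, 1]) \int[mu]_(x in `[0, 1])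
            (expR (- (theta * x * y)) * (1 - x) `^ (theta + 1)) =
  1 - theta * Hfun (theta + 1) + theta * euler_gamma R - theta * 0
  + theta ^+ 2 * 0
  - theta ^+ 2 * \int[mu]_(y in `[0, 1]) \int[mu]_(x in `[0, 1])
            (expR (- (theta * x * y)) * (1 - x) `^ (theta + 1)).
  by rewrite !mulr0 subr0 addr0.
have mulc (c : R) (f : nat -> R) l : f n @[n --> \oo] --> l ->
    c * f n @[n --> \oo] --> c * l.
  by move=> fl; apply: cvgM; [exact: cvg_cst|].
rewrite (eq_cvg _ _ uE).
have t10 : 0 < theta + 1 by rewrite addr_gt0.
apply: cvgB; last by apply: mulc; exact: cvg_double_integral.
apply: cvgD; last by apply: mulc; exact: cvg_telescoping_remainder.
apply: cvgB; last exact: mulc.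
apply: cvgD.
  apply: cvgB; first exact: cvg_cst.
  by apply: mulc; have := cvg_Hfun _ _ t10; rewrite -(cvg_shiftn 1).
by apply: mulc; have := cvg_euler_gamma R; rewrite -(cvg_shiftn 4).
Qed.
End asymptotics.

Arguments expected_cycles {R} theta n.

(** * The expectation of the chain *)
Section chain_expectation.
Context (R : realType) (theta : R) (d : measure_display) (T : measurableType d).
Context (P : probability T R) (n : nat) (eta : nat -> {RV P >-> bool}).
Context (eta_pg : playground_game theta n eta).

Definition prob_one (r : nat) : R := fine (P (pg_at eta r true)).

Lemma measurable_pg_at r b : measurable (pg_at eta r b).
Proof.
rewrite (_ : pg_at eta r b = eta r @^-1` [set b])//.
by rewrite -[X in measurable X]setTI; exact: measurable_funP.
Qed.

Lemma probability_fineK (A : set T) : measurable A -> (fine (P A))%:E = P A.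
Proof. by move=> mA; rewrite fineK// fin_num_measure. Qed.

Lemma pg_atC r : pg_at eta r false = ~` pg_at eta r true.
Proof.
apply/seteqP; split => w /=; rewrite /pg_at/=; first by move=> ->.
by case: (eta r w).
Qed.

Lemma prob_one_compl r : fine (P (pg_at eta r false)) = 1 - prob_one r.
Proof.
by rewrite pg_atC probability_setC ?fineB ?fin_num_measure//=;
  exact: measurable_pg_at.
Qed.

Lemma prob_one_bottom : prob_one 1 = 1.
Proof. by rewrite /prob_one (pg_bottom eta_pg). Qed.

Lemma prob_one_top : prob_one n = 0.
Proof.
have := prob_one_compl n; rewrite (pg_top eta_pg)/= => /eqP.
by rewrite eq_sym subr_eq addrC -subr_eq subrr => /eqP <-.
Qed.

(** Multiplying out makes the transition rules usable without a case split: if [B] is null, both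
    sides are 0. *)
Lemma cond_probM (A B : set T) c : measurable A -> measurable B ->
  (P B != 0%E -> cond_prob P A B = c) ->
  fine (P (A `&` B)) = c * fine (P B).
Proof.
move=> mA mB; have [PB0 _|PB0 <-//] := eqVneq (P B) 0%E.
  have -> : P (A `&` B) = 0%E.
    by apply/eqP; rewrite eq_le measure_ge0 andbT -PB0; apply: le_measure;
      rewrite ?inE//; exact: measurableI.
  by rewrite PB0/= mulr0.
rewrite /cond_prob divfK//.
by rewrite -eqe probability_fineK.
Qed.

Lemma prob_split (A B : set T) : measurable A -> measurable B ->
  fine (P B) = fine (P (A `&` B)) + fine (P (~` A `&` B)).
Proof.
move=> mA mB; rewrite -{1}(setTI B) -(setvU A) setIUl setUC.
rewrite measureU ?fineD ?fin_num_measure//; try exact: measurableI.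
- by apply: measurableI => //; exact: measurableC.
- by apply: measurableI => //; exact: measurableC.
- by rewrite setIACA setICr set0I.
Qed.

(** A 1 is followed by 0 almost surely, so eta_r = 1 can only arise from eta_{r+1} = 0, which gives
    the factor [pg_q theta r]. *)
Lemma prob_one_step r : (2 <= r <= n.-1)%N ->
  prob_one r = pg_q theta r * (1 - prob_one r.+1).
Proof.
move=> rn.
have m s b := measurable_pg_at s b.
have h10 := cond_probM _ _ _ (m r false) (m r.+1 true) (pg_step10 eta_pg rn).
have h01 := cond_probM _ _ _ (m r true) (m r.+1 false) (pg_step01 eta_pg rn).
have := prob_split _ _ (m r true) (m r.+1 true).
rewrite -pg_atC h10 mul1r => /eqP; rewrite -subr_eq subrr eq_sym => /eqP h11.
rewrite {1}/prob_one (prob_split _ _ (m r.+1 true) (m r true)) -pg_atC.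
by rewrite setIC h11 add0r setIC h01 prob_one_compl.
Qed.

Lemma expectation_num_cycles :
  ('E_P[num_cycles n eta])%E = (\sum_(1 <= i < n.+1) prob_one i)%:E.
Proof.
rewrite unlock /num_cycles.
under eq_integral do rewrite -sumEFin.
have etaE i w : ((eta i w : nat)%:R : R) = \1_(pg_at eta i true) w.
  rewrite indicE; congr (nat_of_bool _)%:R.
  by apply/idP/idP; rewrite inE.
rewrite ge0_integral_sum//.
- rewrite -sumEFin; apply: eq_bigr => i _.
  under eq_integral do rewrite etaE.
  rewrite integral_indic ?setIT//; last exact: measurable_pg_at.
  by rewrite probability_fineK//; exact: measurable_pg_at.
- move=> i; apply/measurable_EFinP; under eq_fun do rewrite etaE.
  by apply: measurable_indic; exact: measurable_pg_at.
Qed.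

Context (theta_gt0 : 0 < theta).

Lemma pg_q2 : pg_q theta 2 = 0.
Proof. by rewrite /pg_q /pg_p/= subrr. Qed.

Lemma pg_qE r : (3 <= r)%N -> pg_q theta r = theta / (theta + r%:R - 1).
Proof.
case: r => [//|[//|[//|r]]] _; rewrite /pg_q /pg_p/= -[r.+3%:R]natr1 addrA addrK.
have : theta + r.+2%:R != 0 by rewrite gt_eqF// ltr_wpDr.
by rewrite (addrC r.+2%:R) => h; rewrite -[X in X - _](divff h) -mulrBl addrK.
Qed.

(** Induction on the distance [m] to the top, where the probability is 0. With x = theta + r - 1 the
    recursion reads a_r = (theta / x) (1 - a_{r+1}), and x (x + 1)_(j) = x_(j+1) absorbs the factor
    1 / x. *)
Lemma prob_oneE r m : (3 <= r)%N -> (r + m = n)%N ->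
  prob_one r = \sum_(1 <= j < m.+1)
    (-1) ^+ j.+1 * theta ^+ j / rising (theta + r%:R - 1) j.
Proof.
elim: m r => [|m IH] r r3 rmn.
  by move: rmn; rewrite addn0 => ->; rewrite prob_one_top big_geq.
rewrite prob_one_step; last by lia.
rewrite (IH r.+1) ?addSnnS//; last by lia.
rewrite pg_qE// [RHS]big_ltn// [in RHS]big_add1/= mulrBr mulr1.
rewrite risingSr rising0 addr0 mul1r expr1 sqrrN expr1n mul1r; congr (_ + _).
rewrite mulr_sumr -sumrN; apply: eq_bigr => j _.
have -> : theta + r.+1%:R - 1 = theta + r%:R - 1 + 1 by rewrite -natr1; ring.
rewrite risingSl invfM !exprS; ring.
Qed.

Lemma expectation_num_cyclesE : (3 < n)%N ->
  ('E_P[num_cycles n eta])%E = (expected_cycles theta n)%:E.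
Proof.
move=> n3; rewrite expectation_num_cycles; congr EFin.
(* The indices n, 1 and 2 are split off; they contribute 0, 1 and 0. *)
rewrite big_nat_recr/=; last by lia.
rewrite prob_one_top addr0 big_ltn; last by lia.
rewrite prob_one_bottom big_ltn; last by lia.
rewrite prob_one_step; last by lia.
rewrite pg_q2 mul0r add0r /expected_cycles -addrA; congr (_ + _).
pose F i j := (-1) ^+ j.+1 * theta ^+ j / rising (theta + i%:R - 1) j.
(* The terms j = 1 form the single sum. For the others the range of j is padded to one independent
   of i, with a side condition, so that the sums can be exchanged. *)
transitivity (\sum_(3 <= i < n) (theta / (theta + i%:R - 1) +
    \sum_(2 <= j < (n - 3).+1 | (j < (n - i).+1)%N) F i j)).
  apply: eq_big_nat => i /andP[i3 ilt].
  rewrite (prob_oneE i (n - i)) ?subnKC//; last exact: ltnW.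
  rewrite big_ltn; last by lia.
  rewrite risingSr rising0 addr0 mul1r expr1 sqrrN expr1n mul1r; congr (_ + _).
  by apply: big_nat_widen; lia.
rewrite big_split/=; congr (_ + _).
rewrite (exchange_big_dep_nat xpredT)//=.
apply: eq_big_nat => j /andP[j2 jn].
(* The condition j <= n - i becomes i <= n - j, and j >= 2 keeps this range below n. *)
rewrite [RHS](@big_nat_widen _ _ _ _ _ n); last by lia.
by apply: eq_bigl => i; apply/idP/idP; lia.
Qed.
End chain_expectation.

Theorem theorem1 (R : realType) (theta : R) (theta_gt0 : 0 < theta)
    (d : nat -> measure_display) (T : forall n : nat, measurableType (d n))
    (P : forall n : nat, probability (T n) R)
    (eta : forall n : nat, nat -> {RV (P n) >-> bool})
    (eta_playground :
       forall n : nat, (2 <= n)%N -> playground_game theta n (eta n)) :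
  (forall n : nat, (3 < n)%N ->
    ('E_(P n)[num_cycles n (eta n)])%E =
    (1 + \sum_(3 <= i < n) theta / (theta + i%:R - 1)
       + \sum_(2 <= j < (n - 3).+1) \sum_(3 <= i < (n - j).+1)
           (-1) ^+ j.+1 * theta ^+ j / rising (theta + i%:R - 1) j)%:E)
  /\
  (('E_(P n)[num_cycles n (eta n)] - (theta * ln n%:R)%:E)%E @[n --> \oo] -->
    (1 - theta * Hfun (theta + 1) + theta * euler_gamma R
       - theta ^+ 2 *
         \int[lebesgue_measure]_(y in `[0, 1])
           \int[lebesgue_measure]_(x in `[0, 1])
             (expR (- (theta * x * y)) * (1 - x) `^ (theta + 1)))%:E).
Proof.
have EE n : (3 < n)%N ->
    ('E_(P n)[num_cycles n (eta n)])%E = (expected_cycles theta n)%:E.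
  move=> n3; apply: expectation_num_cyclesE => //.
  by apply: eta_playground; exact: ltnW (ltnW n3).
split; first exact: EE.
have lim : (expected_cycles theta n - theta * ln n%:R)%:E @[n --> \oo] -->
    (1 - theta * Hfun (theta + 1) + theta * euler_gamma R
       - theta ^+ 2 *
         \int[lebesgue_measure]_(y in `[0, 1])
           \int[lebesgue_measure]_(x in `[0, 1])
             (expR (- (theta * x * y)) * (1 - x) `^ (theta + 1)))%:E.
  by apply: cvg_EFin; [exact: nearW|exact: cvg_expected_cycles].
(* The two sequences are known to agree only from n = 4 on, which suffices for the limit. *)
apply: cvg_trans lim; apply: near_eq_cvg; exists 4 => // n /= n4.
by rewrite EE.
Qed.
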